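(* Let $A=\{a_k\}_{k\in\mathbb{Z}}$ and $B=\{b_k\}_{k\in\mathbb{Z}}$ be sequences of complex numbers with $a_k=o(k^{\alpha})$ $(\alpha<1)$ and $b_k=o(k^{\beta})$ $(\beta<1)$ as $k\to\pm\infty$. Then for positive integers $p$ and $q>1$, $$(-1)^{p+q}\sum_{n=1}^\infty \frac{\bar M^{(B)}_n(p)}{(n-1/2)^q}a_n+\sum_{n=1}^\infty \frac{M^{(B)}_{n-1}(p)}{(n-1/2)^q}a_{n-1}$$ $$=(-1)^p \sum_{j=1}^p \binom{p+q-j-1}{q-1} \sum_{n=1}^\infty \frac{T^{(A)}_{n-1}(j)}{(n-1/2)^{p+q-j}}b_{n-1}$$ $$\quad -(-1)^p \sum_{k=0}^{q-1} \binom{p+q-k-2}{p-1} \left((-1)^k R^{(A)}(k+1)-\widehat{R}^{(A)}(k+1) \right)\widehat{R}^{(B)}(p+q-k-1)$$ $$\quad-(-1)^p \binom{p+q-1}{p} \widehat{R}^{(AB)}(p+q).$$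
   Context: For a sequence $A=\{a_k\}_{k\in\mathbb Z}$ (and similarly for $B=\{b_k\}_{k\in\mathbb Z}$) and integers $j\ge1$, $n\ge 0$ define - $R^{(A)}(j)=\sum_{k\ge1}\frac{a_k}{(k-1/2)^j}$ for $j>1$, $R^{(A)}(1)=\sum_{k\ge1}\left(\frac{a_k}{k-1/2}-\frac{a_k}{k}\right)$; - $\widehat R^{(A)}(j)=\sum_{k\ge1}\frac{a_{k-1}}{(k-1/2)^j}$ for $j>1$, $\widehat R^{(A)}(1)=\sum_{k\ge1}\left(\frac{a_{k-1}}{k-1/2}-\frac{a_k}{k}\right)$; - $\widehat R^{(AB)}(j)=\sum_{k\ge1}\frac{a_{k-1}b_{k-1}}{(k-1/2)^j}$; - $E^{(A)}_n(j)=\sum_{k=1}^n\frac{a_{n-k}}{k^j}$, $E^{(A)}_0(j)=0$; $\bar E^{(A)}_n(j)=\sum_{k=1}^n\frac{a_{k-n-1}}{k^j}$, $\bar E^{(A)}_0(j)=0$; - $F^{(A)}_n(1)=\sum_{k\ge1}\frac{a_{k+n}-a_k}{k}$, $F^{(A)}_n(j)=\sum_{k\ge1}\frac{a_{k+n}}{k^j}$ for $j>1$; $\bar F^{(A)}_n(1)=\sum_{k\ge1}\frac{a_{k-n}-a_k}{k}$, $\bar F^{(A)}_n(j)=\sum_{k\ge1}\frac{a_{k-n}}{k^j}$ for $j>1$; - $G^{(A)}_n(j)=E^{(A)}_n(j)-\bar E^{(A)}_{n-1}(j)-\frac{a_0}{n^j}$ for $n\ge1$, $G^{(A)}_0(j)=0$;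 - $L^{(A)}_n(j)=F^{(A)}_n(j)+(-1)^j\bar F^{(A)}_n(j)$; $M^{(A)}_n(j)=E^{(A)}_n(j)+(-1)^jF^{(A)}_n(j)$; - $\bar M^{(A)}_n(j)=\bar F^{(A)}_n(j)-\bar E^{(A)}_{n-1}(j)$ for $n\ge1$; $T^{(A)}_n(j)=G^{(A)}_n(j)+(-1)^jL^{(A)}_n(j)$.
   Formalization: For q = 2 the additional condition α + β < 1 is assumed; without it the series can diverge (p = 1, q = 2, a_k = b_k = k^{0.9} for k ≥ 1 and 0 otherwise). *)

(* Defs.v *)
From HB Require Import structures.
From mathcomp Require Import all_boot all_order all_algebra.
From mathcomp Require Import complex.
From mathcomp Require Import all_classical all_reals all_analysis.

Set Implicit Arguments.
Unset Strict Implicit.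
Unset Printing Implicit Defensive.

Import Order.TTheory GRing.Theory Num.Theory.
Import numFieldNormedType.Exports.

Local Open Scope classical_set_scope.
Local Open Scope ring_scope.
Local Open Scope complex_scope.

(* The sums are defined over an arbitrary numFieldType K, so that K carries   *)
(* its canonical topology; they are used with K := R[i].                      *)
Section ParametricSums.
Context {K : numFieldType}.
Implicit Types (a b : int -> K) (f : nat -> K) (j n : nat).

(* Partial sums f 1 + ... + f n: every series below starts at index 1. *)
Definition series1 f : nat -> K := series (fun m => f m.+1).

Definition sum1 f : K := limn (series1 f).

Definition cvg_sum1 f : Prop := cvgn (series1 f).

Definition half_shift (k : nat) : K := k%:R - 2^-1.

(* In all the families below the exponent j ranges over j >= 1; the value at  *)
(* j = 0 is never used.                                                       *)

Definition sR a j : K :=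
  if j == 1%N then sum1 (fun k => a k%:Z / half_shift k - a k%:Z / k%:R)
  else sum1 (fun k => a k%:Z / half_shift k ^+ j).

Definition sRhat a j : K :=
  if j == 1%N then
    sum1 (fun k => a (k%:Z - 1) / half_shift k - a k%:Z / k%:R)
  else sum1 (fun k => a (k%:Z - 1) / half_shift k ^+ j).

Definition sRhat2 a b j : K :=
  sum1 (fun k => a (k%:Z - 1) * b (k%:Z - 1) / half_shift k ^+ j).

Definition sE a n j : K :=
  \sum_(1 <= k < n.+1) a (n%:Z - k%:Z) / k%:R ^+ j.

Definition sEbar a n j : K :=
  \sum_(1 <= k < n.+1) a (k%:Z - n%:Z - 1) / k%:R ^+ j.

Definition sF a n j : K :=
  if j == 1%N then sum1 (fun k => (a (k%:Z + n%:Z) - a k%:Z) / k%:R)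
  else sum1 (fun k => a (k%:Z + n%:Z) / k%:R ^+ j).

Definition sFbar a n j : K :=
  if j == 1%N then sum1 (fun k => (a (k%:Z - n%:Z) - a k%:Z) / k%:R)
  else sum1 (fun k => a (k%:Z - n%:Z) / k%:R ^+ j).

Definition sG a n j : K :=
  if n == 0%N then 0 else sE a n j - sEbar a n.-1 j - a 0 / n%:R ^+ j.

Definition sL a n j : K := sF a n j + (-1) ^+ j * sFbar a n j.

Definition sM a n j : K := sE a n j + (-1) ^+ j * sF a n j.

(* Only meaningful, and only used, for n >= 1. *)
Definition sMbar a n j : K := sFbar a n j - sEbar a n.-1 j.

Definition sT a n j : K := sG a n j + (-1) ^+ j * sL a n j.

End ParametricSums.

(* a_k = o(|k|^alpha) as k -> +oo and as k -> -oo; R[i]^o is R[i] seen as a   *)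
(* normed module over itself, as Landau notation requires.                    *)
Definition littleo_pow {R : realType} (a : int -> R[i]) (alpha : R) : Prop :=
  ((fun n : nat => a n%:Z : R[i]^o) =o_\oo
     (fun n : nat => (n%:R `^ alpha)%:C : R[i]^o)) /\
  ((fun n : nat => a (- n%:Z) : R[i]^o) =o_\oo
     (fun n : nat => (n%:R `^ alpha)%:C : R[i]^o)).

(* Main.v *)
Require Import Defs.
From HB Require Import structures.
From mathcomp Require Import all_boot all_order all_algebra.
From mathcomp Require Import complex.
From mathcomp Require Import all_classical all_reals all_analysis.
From mathcomp Require Import ring lra zify.

(** Put c_nu = a_|nu| for nu in Z.  Unfolding the definitions, the two series on
the left are together the double series
  sum over nu in Z and m >= 0, m != nu, of
    c_nu b_m / ((nu + 1/2)^q (nu - m)^p),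
the indices nu >= 0 contributing M and the indices nu = -n < 0 contributing
Mbar.  With x = nu + 1/2 and y = m + 1/2 one has nu - m = x - y, and the partial
fraction decomposition of 1 / (x^q (x - y)^p) in x has two kinds of terms.  The
poles at x = y give sums over nu of c_nu / (m - nu)^j, that is T(j).  The poles at
x = 0 give products of a sum over nu, which is Rhat(k) + (-1)^k R(k) for A, and a
sum over m, which is Rhat for B.  Those products include the diagonal nu = m,
absent on the left; by a hockey-stick summation of the binomials its removal
costs the last term, in Rhat^(AB).

The sums with j = 1 or k = 1 do not converge absolutely, so the decomposition is
not applied to the full double series.  It is applied to the square n, m < N,
where it is pure algebra (truncated_identity), and then every part of the
identity is passed to the limit separately.  The regularising terms of the sums
with exponent 1 are built into the kernels kerM, kerMbar, kerRhat and kerR, and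
nu is folded onto -nu, which turns the principal value defining T(1) into an
absolutely convergent series.

The limit is Tannery's theorem (tannery, square_sum_cvg).  All three kernels are
bounded by a constant times
  decay n m = (n + 1) / ((m + 1) (1 + |n - m|)),
and summing decay n m against (m + 1)^be over m costs only a factor
(n + 1)^(be + d) with d > 0 arbitrarily small (sum_powR_decay_le).  What remains
is the sum over n of (n + 1)^(al + be + d - q), which converges as soon as
al + be < q - 1: this is automatic for q >= 3, and it is the extra hypothesis
when q = 2. *)

Set Implicit Arguments.
Unset Strict Implicit.
Unset Printing Implicit Defensive.

Import Order.TTheory GRing.Theory Num.Theory.
Import numFieldNormedType.Exports.

Local Open Scope ring_scope.
Local Open Scope complex_scope.

(** * Partial fractions *)

Lemma hockey_stick p q :
  (\sum_(1 <= k < q.+2) 'C((p + q).+1 - k, p) = 'C((p + q).+1, p.+1))%N.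
Proof.
elim: q => [|q IHq]; first by rewrite big_nat1 addn0 subSS subn0 !binn.
by rewrite big_nat_recl //= subSS subn0 addnS binS -IHq addnC.
Qed.

Lemma partial_fraction_geom (A : comPzRingType) (u v : A) q :
  u * v = u + v -> u * v ^+ q.+1 = u + \sum_(1 <= k < q.+2) v ^+ k.
Proof.
move=> uv; elim: q => [|q IHq]; first by rewrite expr1 big_nat1 expr1.
rewrite exprSr mulrA IHq mulrDl uv -addrA; congr (_ + _).
rewrite [RHS]big_nat_recl //= expr1 mulr_suml; congr (_ + _).
by apply: eq_big_nat => k _; rewrite exprSr.
Qed.

(** Homogeneous form of the decomposition: u = 1/s and v = 1/t with s + t = 1
satisfy u v = u + v.  Multiplying u^(p+1) v^(q+1) by u v = u + v shows that both
sides obey the recursion of Pascal's triangle. *)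
Lemma partial_fraction_uv (A : comPzRingType) (u v : A) p q :
  u * v = u + v ->
  u ^+ p.+1 * v ^+ q.+1 =
    \sum_(1 <= j < p.+2) 'C((p + q).+1 - j, q)%:R * u ^+ j
    + \sum_(1 <= k < q.+2) 'C((p + q).+1 - k, p)%:R * v ^+ k.
Proof.
move=> uv; pose S p q (w : A) : A :=
  \sum_(1 <= j < p.+2) 'C((p + q).+1 - j, q)%:R * w ^+ j.
have S0 r w : S 0%N r w = w.
  by rewrite /S big_nat1 add0n subSS subn0 binn mul1r expr1.
have Sn0 r w : S r 0%N w = \sum_(1 <= j < r.+2) w ^+ j.
  by apply: eq_big_nat => j _; rewrite bin0 mul1r.
have SS r s w : S r.+1 s.+1 w = S r s.+1 w + S r.+1 s w.
  rewrite /S [in LHS]big_nat_recr // [X in _ = _ + X]big_nat_recr //= addrA.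
  rewrite -big_split /=; congr (_ + _).
    apply: eq_big_nat => j /andP[j0 jr].
    have -> : ((r.+1 + s.+1).+1 - j = ((r.+1 + s).+1 - j).+1)%N by lia.
    by rewrite binS natrD mulrDl addnS addSn.
  have -> : ((r.+1 + s.+1).+1 - r.+2 = s.+1)%N by lia.
  have -> : ((r.+1 + s).+1 - r.+2 = s)%N by lia.
  by rewrite !binn.
rewrite -/(S p q u) [in X in _ = _ + X]addnC -/(S q p v).
elim: p q => [|p IHp] q.
  by rewrite expr1 S0 Sn0 partial_fraction_geom.
elim: q => [|q IHq].
  have vu : v * u = v + u by rewrite mulrC addrC.
  by rewrite expr1 S0 Sn0 mulrC (partial_fraction_geom _ vu) addrC.
have -> : u ^+ p.+2 * v ^+ q.+2 = (u * v) * (u ^+ p.+1 * v ^+ q.+1).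
  by rewrite exprS (exprS v) mulrACA.
rewrite uv mulrDl mulrA -exprS mulrCA -exprS IHq IHp !SS.
by rewrite addrACA [S p.+1 q u + _]addrC [S q p.+1 v + _]addrC.
Qed.

(** Since 0^-1 = 0, the left-hand side vanishes for x = y, whereas the sum over k
does not: the last term repairs exactly this, so that the formula can be summed
over a whole square without excluding the diagonal. *)
Lemma partial_fraction (K : fieldType) (x y : K) p q :
    (0 < p)%N -> (0 < q)%N -> x != 0 -> y != 0 ->
  ((y - x) ^+ p)^-1 / x ^+ q =
    \sum_(1 <= j < p.+1) 'C(p + q - j - 1, q - 1)%:R *
       (((y - x) ^+ j)^-1 / y ^+ (p + q - j))
    + \sum_(0 <= k < q) 'C(p + q - k - 2, p - 1)%:R *
       ((x ^+ k.+1)^-1 / y ^+ (p + q - k - 1))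
    - 'C(p + q - 1, p)%:R * (x == y)%:R / y ^+ (p + q).
Proof.
case: p => // p; case: q => // q _ _ x0 y0.
have [-> ->] : (p.+1 - 1 = p /\ q.+1 - 1 = q)%N by rewrite !subn1.
have [<-|xy] := eqVneq x y.
  rewrite subrr expr0n /= invr0 mul0r big_nat_cond big1 ?add0r; last first.
    by move=> [|j] //; rewrite exprS mul0r invr0 mul0r mulr0.
  have E k : (0 <= k < q.+1)%N ->
      'C(p.+1 + q.+1 - k - 2, p)%:R
        * ((x ^+ k.+1)^-1 / x ^+ (p.+1 + q.+1 - k - 1))
      = 'C((p + q).+1 - k.+1, p)%:R / x ^+ (p.+1 + q.+1).
    move=> kq; rewrite -invfM -exprD; congr (_%:R / x ^+ _); last by lia.
    by congr 'C(_, _); lia.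
  rewrite (eq_big_nat _ _ E) -mulr_suml -natr_sum mulr1.
  have -> : (\sum_(0 <= k < q.+1) 'C((p + q).+1 - k.+1, p)
             = 'C((p + q).+1, p.+1))%N.
    by rewrite -hockey_stick big_add1.
  have -> : (p.+1 + q.+1 - 1 = (p + q).+1)%N by lia.
  by rewrite subrr.
have d0 : y - x != 0 by rewrite subr_eq0 eq_sym.
rewrite mulr0 mul0r subr0.
have uv : y / (y - x) * (y / x) = y / (y - x) + y / x by field; rewrite d0 x0.
have := @partial_fraction_uv _ _ _ p q uv.
move/(congr1 (fun z => z / y ^+ (p.+1 + q.+1))).
rewrite mulrDl !mulr_suml => E; apply: etrans (etrans E _).
  rewrite !expr_div_n exprD; field.
  by rewrite !expf_neq0.
congr (_ + _).
  apply: eq_big_nat => j /andP[j0 jp].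
  have -> : 'C(p.+1 + q.+1 - j - 1, q) = 'C((p + q).+1 - j, q).
    by congr 'C(_, _); lia.
  rewrite -mulrA; congr (_ * _).
  have -> : y ^+ (p.+1 + q.+1) = y ^+ j * y ^+ (p.+1 + q.+1 - j).
    by rewrite -exprD; congr (_ ^+ _); lia.
  by rewrite expr_div_n; field; rewrite !expf_neq0.
rewrite big_add1 /=; apply: eq_big_nat => k /andP[_ kq].
have -> : 'C(p.+1 + q.+1 - k - 2, p) = 'C((p + q).+1 - k.+1, p).
  by congr 'C(_, _); lia.
rewrite -mulrA; congr (_ * _).
have -> : y ^+ (p.+1 + q.+1) = y ^+ k.+1 * y ^+ (p.+1 + q.+1 - k - 1).
  by rewrite -exprD; congr (_ ^+ _); lia.
by rewrite expr_div_n; field; rewrite !expf_neq0.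
Qed.

(** * The square-truncated identity *)

Section Kernels.
Context {K : numFieldType}.
Implicit Types (n m j s p q : nat).

(** Summed over m against a sequence, these kernels give M, Mbar and T.  As
division by 0 yields 0, the index m = n is dropped by kerM without a case
distinction; the term in 1/m is the regularisation that F(1) and its mirror image
carry. *)
Definition kerM p n m : K :=
  ((n%:R - m%:R) ^+ p)^-1 + (p == 1%N)%:R / m%:R.

Definition kerMbar p n m : K :=
  ((n%:R + m%:R) ^+ p)^-1 - (p == 1%N)%:R / m%:R.

Definition kerT j n m : K :=
  kerM j n m + kerMbar j n m - (m == 0%N)%:R / n%:R ^+ j.

(** Both kernels carry the same regularising term for s = 1, so it cancels in the
only combination of R(1) and Rhat(1) that occurs for the sequence A. *)
Definition kerRhat s n : K :=
  (half_shift n.+1 ^+ s)^-1 - (s == 1%N)%:R / n%:R.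

Definition kerR s n : K :=
  (n != 0%N)%:R / half_shift n ^+ s - (s == 1%N)%:R / n%:R.

Lemma half_shiftSE n : half_shift n.+1 = n%:R + 2^-1 :> K.
Proof. by rewrite /half_shift -natr1; field. Qed.

Lemma half_shift_neq0 n : half_shift n.+1 != 0 :> K.
Proof. by rewrite half_shiftSE gt_eqF // ltr_wpDl ?ler0n // invr_gt0 ltr0n. Qed.

(** The identity term by term: the decomposition at x = n + 1/2 (from kerM) plus
the one at the reflected point x' = 1/2 - n (from kerMbar).  For p = 1 the
regularising terms 1/m on both sides meet in the single index k = q - 1. *)
Lemma kernel_identity p q n m : (0 < p)%N -> (1 < q)%N ->
  (-1) ^+ (p + q) * ((n != 0%N)%:R / half_shift n ^+ q) * kerMbar p n m
    + (half_shift n.+1 ^+ q)^-1 * kerM p n m =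
  (-1) ^+ p *
    (\sum_(1 <= j < p.+1) 'C(p + q - j - 1, q - 1)%:R *
       (kerT j m n / half_shift m.+1 ^+ (p + q - j)))
  - (-1) ^+ p *
    (\sum_(0 <= k < q) 'C(p + q - k - 2, p - 1)%:R *
       ((-1) ^+ k * kerR k.+1 n - kerRhat k.+1 n) * kerRhat (p + q - k - 1) m)
  - (-1) ^+ p * 'C(p + q - 1, p)%:R *
    ((n == m)%:R / half_shift n.+1 ^+ (p + q)).
Proof.
move=> p0 q1; have q0 : (0 < q)%N by lia.
set y : K := half_shift m.+1; pose x : K := half_shift n.+1.
have y0 : y != 0 := half_shift_neq0 m.
have x0 : x != 0 := half_shift_neq0 n.
(* The reflected index -n contributes only when n != 0. *)
pose x' : K := - half_shift n.
have xy : (x == y) = (n == m).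
  by rewrite /x /y !half_shiftSE (inj_eq (addIr _)) eqr_nat.
have yx : y - x = m%:R - n%:R by rewrite /x /y !half_shiftSE; ring.
have PF := partial_fraction p0 q0 x0 y0.
pose e : K := (n != 0%N)%:R.
have PF' : e * (((m%:R + n%:R) ^+ p)^-1 / x' ^+ q) =
  e * (\sum_(1 <= j < p.+1) 'C(p + q - j - 1, q - 1)%:R *
       (((m%:R + n%:R) ^+ j)^-1 / y ^+ (p + q - j))
    + \sum_(0 <= k < q) 'C(p + q - k - 2, p - 1)%:R *
       ((x' ^+ k.+1)^-1 / y ^+ (p + q - k - 1))).
  rewrite /e; case: n @x x0 @x' xy yx {PF e} => [|n] x x0 x' xy yx.
    by rewrite !mul0r.
  have x'0 : x' != 0 by rewrite oppr_eq0 half_shift_neq0.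
  have yx' : y - x' = m%:R + n.+1%:R.
    by rewrite /x' /y /half_shift -!natr1; field.
  have /negbTE x'y : x' != y.
    rewrite -subr_eq0 -opprB yx' oppr_eq0 -natrD pnatr_eq0; lia.
  have := partial_fraction p0 q0 x'0 y0.
  by rewrite x'y mulr0 mul0r subr0 yx' => ->.
(* kerRhat (p + q - k - 1) is regularised only for k = q - 1 and p = 1. *)
have reg k : (0 <= k < q)%N -> ((p + q - k - 1 == 1) = (k == q.-1) && (p == 1))%N.
  by lia.
have x'V k : (x' ^+ k)^-1 = (-1) ^+ k / half_shift n ^+ k.
  by rewrite /x' -[- half_shift n]mulN1r exprMn invfM invr_sign.
pose Z k : K := e / x' ^+ k.+1 + (x ^+ k.+1)^-1.
have TE : \sum_(1 <= j < p.+1) 'C(p + q - j - 1, q - 1)%:R *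
       (kerT j m n / y ^+ (p + q - j)) =
    \sum_(1 <= j < p.+1) 'C(p + q - j - 1, q - 1)%:R *
       (((y - x) ^+ j)^-1 / y ^+ (p + q - j)) +
  e * \sum_(1 <= j < p.+1) 'C(p + q - j - 1, q - 1)%:R *
       (((m%:R + n%:R) ^+ j)^-1 / y ^+ (p + q - j)).
  rewrite mulr_sumr -big_split /=; apply: eq_big_nat => j _.
  rewrite [e * _]mulrCA -mulrDr [e * (_ / _)]mulrA -mulrDl; congr (_ * (_ / _)).
  rewrite yx /kerT /kerM /kerMbar /e; case: (n) => [|n'] /=.
    by rewrite addr0 mul1r mul0r; ring.
  by rewrite mul0r mul1r; ring.
have RE : \sum_(0 <= k < q) 'C(p + q - k - 2, p - 1)%:R *
       ((-1) ^+ k * kerR k.+1 n - kerRhat k.+1 n) * kerRhat (p + q - k - 1) m =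
   (p == 1%N)%:R * Z q.-1 / m%:R -
    (\sum_(0 <= k < q) 'C(p + q - k - 2, p - 1)%:R *
       ((x ^+ k.+1)^-1 / y ^+ (p + q - k - 1))
    + e * \sum_(0 <= k < q) 'C(p + q - k - 2, p - 1)%:R *
       ((x' ^+ k.+1)^-1 / y ^+ (p + q - k - 1))).
  have -> : (p == 1%N)%:R * Z q.-1 / m%:R =
      \sum_(0 <= k < q) 'C(p + q - k - 2, p - 1)%:R *
        (Z k * (p + q - k - 1 == 1)%N%:R / m%:R).
    rewrite -{1 2}(prednK q0) big_nat_recr //= big_nat_cond big1 ?add0r.
      rewrite reg ?ltn_predL ?eqxx //=; have [->|] := eqVneq p 1%N.
        by rewrite subnn bin0 !mul1r mulr1.
      by rewrite /= mul0r mulr0 !mul0r mulr0.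
    move=> k; rewrite andbT => kq; rewrite reg; last by lia.
    have /negbTE-> : k != q.-1 by lia.
    by rewrite mulr0 mul0r mulr0.
  rewrite mulr_sumr -big_split -sumrB /=; apply: eq_big_nat => k _.
  have c0 : (-1) ^+ k * ((k.+1 == 1%N)%:R / n%:R) = (k.+1 == 1%N)%:R / n%:R :> K.
    by case: k => [|k]; rewrite ?mul1r //= !mul0r mulr0.
  rewrite /kerRhat -/x -/y /kerR /Z -/e !x'V [(-1) ^+ k * (_ - _)]mulrBr c0 (exprS (-1)).
  set w : K := (_ == _)%:R; set w' : K := (_ == _)%:R.
  by ring.
rewrite TE RE {TE RE}.
have -> : (n == m)%:R / x ^+ (p + q) = (x == y)%:R / y ^+ (p + q).
  by rewrite -xy; case: eqP => [->|]; rewrite ?mul0r.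
have -> : (-1) ^+ (p + q) * (e / half_shift n ^+ q) * kerMbar p n m =
   (-1) ^+ p * (e * (((m%:R + n%:R) ^+ p)^-1 / x' ^+ q))
   + (p == 1%N)%:R * (e / x' ^+ q / m%:R).
  rewrite /kerMbar x'V [m%:R + _]addrC exprD.
  by case: eqVneq => [->|_] /=; rewrite ?expr1; ring.
have -> : (x ^+ q)^-1 * kerM p n m =
   (-1) ^+ p * (((y - x) ^+ p)^-1 / x ^+ q) + (p == 1%N)%:R / x ^+ q / m%:R.
  rewrite /kerM yx -[n%:R - _]opprB -[- (m%:R - _)]mulN1r exprMn invfM invr_sign.
  by ring.
rewrite PF PF' /Z prednK // x'V.
case: (eqVneq p 1%N) => [->|_] /=; ring.
Qed.

Lemma truncated_identity (a b : nat -> K) N p q : (0 < p)%N -> (1 < q)%N ->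
  (-1) ^+ (p + q) * (\sum_(0 <= n < N) \sum_(0 <= m < N)
      a n * ((n != 0%N)%:R / half_shift n ^+ q) * (b m * kerMbar p n m))
  + \sum_(0 <= n < N) \sum_(0 <= m < N)
      a n * (half_shift n.+1 ^+ q)^-1 * (b m * kerM p n m) =
  (-1) ^+ p *
    (\sum_(1 <= j < p.+1) 'C(p + q - j - 1, q - 1)%:R *
       \sum_(0 <= m < N) \sum_(0 <= n < N)
         b m * (half_shift m.+1 ^+ (p + q - j))^-1 * (a n * kerT j m n))
  - (-1) ^+ p *
    (\sum_(0 <= k < q) 'C(p + q - k - 2, p - 1)%:R *
       ((-1) ^+ k * (\sum_(0 <= n < N) a n * kerR k.+1 n)
         - \sum_(0 <= n < N) a n * kerRhat k.+1 n)
       * \sum_(0 <= m < N) b m * kerRhat (p + q - k - 1) m)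
  - (-1) ^+ p * 'C(p + q - 1, p)%:R *
    \sum_(0 <= n < N) a n * b n / half_shift n.+1 ^+ (p + q).
Proof.
move=> p0 q1.
transitivity (\sum_(0 <= n < N) \sum_(0 <= m < N) a n * b m *
  ((-1) ^+ (p + q) * ((n != 0%N)%:R / half_shift n ^+ q) * kerMbar p n m
    + (half_shift n.+1 ^+ q)^-1 * kerM p n m)).
  rewrite mulr_sumr -big_split; apply: eq_bigr => n _ /=.
  rewrite mulr_sumr -big_split; apply: eq_bigr => m _ /=.
  ring.
under eq_bigr do under eq_bigr do rewrite kernel_identity // !mulrBr.
under eq_bigr do rewrite !sumrB.
rewrite !sumrB; congr (_ - _ - _).
- rewrite exchange_big mulr_sumr /=.
  under [RHS]eq_bigr do rewrite mulr_sumr mulr_sumr.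
  rewrite [RHS]exchange_big /=; apply: eq_bigr => m _.
  under [RHS]eq_bigr do rewrite mulr_sumr mulr_sumr.
  rewrite [RHS]exchange_big /=; apply: eq_bigr => n _.
  by rewrite !mulr_sumr; apply: eq_bigr => j _; ring.
- rewrite [in RHS]mulr_sumr.
  under eq_bigr do under eq_bigr do rewrite !mulr_sumr.
  under eq_bigr do rewrite exchange_big /=.
  rewrite exchange_big /=; apply: eq_bigr => k _.
  rewrite [X in X - _]mulr_sumr -sumrB.
  rewrite -[_ * _ * (\sum_(0 <= m < N) _)]mulrA mulr_suml !mulr_sumr.
  apply: eq_bigr => n _; rewrite !mulr_sumr; apply: eq_bigr => m _.
  ring.
rewrite mulr_sumr; apply: eq_big_nat => n nN.
rewrite (bigD1_seq n) ?mem_index_iota ?iota_uniq //= big1 ?addr0 => [|m mn].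
  by rewrite eqxx mul1r; ring.
by rewrite eq_sym (negbTE mn) mul0r !mulr0.
Qed.

End Kernels.

(** * Normally convergent complex series *)

Section DominatedSums.
Local Open Scope classical_set_scope.
Context {K : numFieldType}.

Lemma cvgn_ext (u v : nat -> K) (l : K) :
  u =1 v -> u @ \oo --> l -> v @ \oo --> l.
Proof. by move/funext->. Qed.

Lemma cvg_finite_sum (k N : nat) (u : nat -> nat -> K) (l : nat -> K) :
    (forall n, (k <= n < N)%N -> u^~ n @ \oo --> l n) ->
  (fun i => \sum_(k <= n < N) u i n) @ \oo --> \sum_(k <= n < N) l n.
Proof.
move=> ul; have {}ul n : n \in index_iota k N -> u^~ n @ \oo --> l n.
  by rewrite mem_index_iota; exact: ul.
elim: (index_iota k N) ul => [|n r IHr] ul.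
  under eq_fun do rewrite big_nil.
  by rewrite big_nil; exact: cvg_cst.
under eq_fun do rewrite big_cons.
rewrite big_cons; apply: cvgD; first by apply: ul; rewrite mem_head.
by apply: IHr => i ir; apply: ul; rewrite in_cons ir orbT.
Qed.

Definition square_summable (f : nat -> nat -> K) : Prop :=
  [/\ forall n, cvgn (series (f n)),
      cvgn (series (fun n => limn (series (f n)))) &
      (fun N => \sum_(0 <= n < N) \sum_(0 <= m < N) f n m) @ \oo -->
        limn (series (fun n => limn (series (f n))))].

(** The first terms converge individually, and the remaining ones are at most a
tail of the convergent series of the bounds, uniformly in N. *)
Lemma tannery (h : nat -> nat -> K) (g : nat -> K) (B : nat -> K) :
    (forall n, h^~ n @ \oo --> g n) -> (forall N n, `|h N n| <= B n) ->
    (forall n, `|g n| <= B n) -> cvgn (series B) -> cvgn (series g) ->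
  (fun N => \sum_(0 <= n < N) h N n) @ \oo --> limn (series g).
Proof.
move=> hg hB gB cB cg.
suff hg0 : (fun N => \sum_(0 <= n < N) (h N n - g n)) @ \oo --> (0 : K).
  rewrite -[limn _]add0r; apply: cvgn_ext (cvgD hg0 cg) => N.
  by rewrite -[LHS]/(_ + series g N) -big_split; apply: eq_bigr => n _; exact: subrK.
apply/cvgrPdist_le => e e0.
have e40 : 0 < e / 4 by rewrite divr_gt0.
have [k _ kB] : \forall k \near \oo, forall N, (k <= N)%N ->
    `|\sum_(k <= n < N) B n| < e / 4.
  have cauchyB := (cauchy_seriesP B).1 (cvg_cauchy _ cB).
  have [[U V] /= [[k _ kU] [k' _ kV]] UV] := cauchyB _ _ e40.
  exists (maxn k k') => // n /=; rewrite geq_max => /andP[kn k'n] N nN.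
  by apply: (UV (n, N)); split; [exact: kU | exact/kV/(leq_trans k'n nN)].
have e20 : 0 < e / 2 by rewrite divr_gt0.
have /cvgrPdist_le/(_ _ e20) head : (fun N => \sum_(0 <= n < k) (h N n - g n))
    @ \oo --> \sum_(0 <= n < k) (g n - g n).
  by apply: cvg_finite_sum => n _; apply: cvgB => //; exact: cvg_cst.
near=> N; have kN : (k <= N)%N by near: N; exact: nbhs_infty_ge.
rewrite (big_cat_nat (leq0n k) kN) /= sub0r normrN (le_trans (ler_normD _ _)) //.
have -> : e = e / 2 + (e / 4 + e / 4) by field.
apply: lerD.
  near: N; apply: filterS head => N.
  by rewrite [X in X - _]big1 ?sub0r ?normrN // => i _; rewrite subrr.
have B0 n : 0 <= B n := le_trans (normr_ge0 _) (gB n).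
apply: le_trans (ler_norm_sum _ _ _) _.
apply: (@le_trans _ _ (\sum_(k <= n < N) (B n + B n))).
  by apply: ler_sum => n _; rewrite (le_trans (ler_normB _ _)) // lerD.
have /ltW := kB k (leqnn k) N kN; rewrite ger0_norm ?sumr_ge0 // => kNB.
by rewrite big_split lerD.
Unshelve. all: by end_near. Qed.

End DominatedSums.

Section ComplexSeries.
Local Open Scope classical_set_scope.
Context {R : realType}.
(* The topology of R[i] is the one of the field structure it is cast to. *)
Local Notation C := (Num.NumField.sort (R[i] : numFieldType)).
Implicit Types (u f g : nat -> C) (x : R) (z : R[i]).

Lemma gt0_realC z : 0 < z -> exists2 e : R, 0 < e & z = e%:C.
Proof.
case: z => x y; rewrite ltcE /= => /andP[/eqP y0 x0].
by exists x => //; rewrite y0.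
Qed.

Lemma normc_real x : `|x%:C| = `|x|%:C :> R[i].
Proof. by rewrite normc_def /= expr0n addr0 sqrtr_sqr. Qed.

Lemma normc_Im z : `|complex.Im z|%:C <= `|z|.
Proof. by rewrite normc_def lecR -sqrtr_sqr ler_wsqrtr // lerDr sqr_ge0. Qed.

Lemma norm_leC_ge0 z x : `|z| <= x%:C -> 0 <= x.
Proof. by move=> zx; rewrite -lecR; apply: le_trans (normr_ge0 z) zx. Qed.

Lemma cvg_realC (v : nat -> R) x :
  v @ \oo --> x -> (fun n => (v n)%:C : C) @ \oo --> (x%:C : C).
Proof.
move/cvgrPdist_le => vx; apply/cvgrPdist_le => _ /gt0_realC[e e0 ->].
near=> n; rewrite -rmorphB /= normc_real lecR; near: n; exact: vx.
Unshelve. all: by end_near. Qed.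

(** Real and imaginary parts converge absolutely. *)
Lemma cvg_series_norm_le f (g : nat -> R) :
  (forall n, `|f n| <= (g n)%:C) -> cvgn (series g) -> cvgn (series f).
Proof.
move=> fg cg.
have g0 n : 0 <= g n by exact: norm_leC_ge0 (fg n).
have part (v : nat -> R) : (forall n, `|v n|%:C <= `|f n|) -> cvgn (series v).
  move=> vf; apply: normed_cvg; apply: series_le_cvg cg => // n /=.
    exact: normr_ge0.
  by rewrite -lecR; exact: (le_trans (vf n) (fg n)).
have /cvg_ex[lr cr] : cvgn (series (fun n => complex.Re (f n))).
  by apply: part => n; exact: normc_ge_Re.
have /cvg_ex[li ci] : cvgn (series (fun n => complex.Im (f n))).
  by apply: part => n; exact: normc_Im.
apply/cvg_ex; exists (lr%:C + 'i%C * li%:C : C).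
rewrite [series f](_ : _ = fun n =>
  (series (fun n => complex.Re (f n)) n)%:C
  + 'i%C * (series (fun n => complex.Im (f n)) n)%:C : C).
  by apply: cvgD; [exact: cvg_realC | apply: cvgMl_tmp; exact: cvg_realC].
apply/funext => n; rewrite /series /= !rmorph_sum mulr_sumr -big_split /=.
by apply: eq_bigr => i _; rewrite -complexE.
Qed.

(** The truncated rows are dominated by B uniformly in the truncation, which is
what Tannery's theorem asks for. *)
Lemma square_sum_cvg (f : nat -> nat -> C) (G : nat -> nat -> R)
    (B : nat -> R) :
    (forall n m, `|f n m| <= (G n m)%:C) ->
    (forall n N, \sum_(0 <= m < N) G n m <= B n) -> cvgn (series B) ->
  square_summable f.
Proof.
move=> fG GB cB.
have G0 n m : 0 <= G n m by exact: norm_leC_ge0 (fG n m).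
have rows n : cvgn (series (f n)).
  apply: cvg_series_norm_le (fG n) _; apply: nondecreasing_is_cvgn.
    by apply/nondecreasing_series.
  by exists (B n) => _ [N _ <-]; exact: GB.
have SB n N : `|\sum_(0 <= m < N) f n m| <= (B n)%:C.
  apply: le_trans (ler_norm_sum _ _ _) _.
  apply: (@le_trans _ _ (\sum_(0 <= m < N) (G n m)%:C)); first exact: ler_sum.
  by rewrite -rmorph_sum lecR.
have gB n : `|limn (series (f n))| <= (B n)%:C.
  apply/ler_addgt0Pr => e e0.
  have /cvgrPdist_le/(_ e e0)[N _ /(_ N (leqnn N)) /= d] := rows n.
  rewrite -[limn _](subrK (series (f n) N)) (le_trans (ler_normD _ _)) // addrC.
  by apply: lerD => //; exact: SB.
have cg := cvg_series_norm_le gB cB.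
have cBC : cvgn (series (fun n => (B n)%:C : C)).
  apply/cvg_ex; exists ((limn (series B))%:C : C).
  apply: cvgn_ext (cvg_realC cB) => N.
  by rewrite /series /= rmorph_sum.
split; [exact: rows | exact: cg |].
exact: (@tannery _ (fun N n => \sum_(0 <= m < N) f n m)
  (fun n => limn (series (f n))) _ rows (fun N n => SB n N) gB cBC cg).
Qed.

End ComplexSeries.

(** * Power sums and the decay of the kernels *)

Section PowerSums.
Local Open Scope classical_set_scope.
Context {R : realType}.
Implicit Types (x y z r s d e : R) (n m N : nat).

Lemma powRDr x r s : 0 < x -> x `^ (r + s) = x `^ r * x `^ s.
Proof. by move=> x0; rewrite powRD // (gt_eqF x0) implybT. Qed.

Lemma ler_powRN x y r : 0 < x -> x <= y -> r <= 0 -> y `^ r <= x `^ r.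
Proof.
move=> x0 xy r0; rewrite -[r]opprK powRN [x `^ _]powRN lef_pV2 ?posrE ?powR_gt0 //.
  by rewrite ge0_ler_powR ?nnegrE ?oppr_ge0 ?(ltW x0) ?(le_trans (ltW x0)).
exact: lt_le_trans xy.
Qed.

(** Discrete form of the derivative of t^(-d), obtained from 1 + t <= e^t: it makes
the sum of the (m + 1)^(-1-d) telescope. *)
Lemma powR_telescope x y d : 0 < x -> 0 < y -> 0 < d ->
  d * (y - x) * y `^ (- 1 - d) <= x `^ (- d) - y `^ (- d).
Proof.
move=> x0 y0 d0.
have -> : x `^ (- d) = y `^ (- d) * expR (d * (ln y - ln x)).
  by rewrite /powR !gt_eqF // -expRD; congr expR; ring.
have -> : y `^ (- 1 - d) = y `^ (- d) * y^-1.
  by rewrite powRDr // powR_inv1 ?ltW // mulrC.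
rewrite -[X in _ <= _ - X]mulr1 -mulrBr mulrCA ler_pM2l ?powR_gt0 // lerBrDl.
apply: le_trans (expR_ge1Dx _); rewrite lerD2l -mulrA ler_pM2l //.
rewrite mulrBl divff ?gt_eqF // -[ln y - _]opprB lerNr opprB.
rewrite -ln_div ?posrE // -{1}[x / y](subrK 1) addrC le_ln1Dx //.
by rewrite ltrBrDl subrr divr_gt0.
Qed.

Lemma sum_powR_le d N : 0 < d ->
  \sum_(0 <= m < N) m.+1%:R `^ (- 1 - d) <= 1 + d^-1.
Proof.
move=> d0; case: N => [|N]; first by rewrite big_nil addr_ge0 ?invr_ge0 ?ltW.
suff : \sum_(0 <= m < N.+1) m.+1%:R `^ (- 1 - d)
       <= 1 + d^-1 * (1 - N.+1%:R `^ (- d)).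
  move/le_trans; apply; rewrite lerD2l ler_piMr ?invr_ge0 ?ltW //.
elim: N => [|N IHN]; first by rewrite big_nat1 !powR1 subrr mulr0 addr0.
have dV0 : 0 <= d^-1 by rewrite invr_ge0 ltW.
rewrite big_nat_recr //=.
have := powR_telescope (ltr0Sn R N) (ltr0Sn R N.+1) d0.
rewrite -natrB // subSnn mulr1 => /(ler_wpM2l dV0).
by rewrite mulrA mulVf ?gt_eqF // mul1r mulrBr; move: IHN; rewrite !mulrBr; lra.
Qed.

Lemma cvg_series_powR d : 0 < d ->
  cvgn (series (fun n => n.+1%:R `^ (- 1 - d) : R)).
Proof.
move=> d0; apply: nondecreasing_is_cvgn.
  by apply/nondecreasing_series => *; exact: powR_ge0.
by exists (1 + d^-1) => _ [N _ <-]; exact: sum_powR_le.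
Qed.

Definition natdist n m : nat := (n - m) + (m - n).

Lemma sum_natdist_le (phi : nat -> R) z n N :
    (forall i, 0 <= phi i) ->
    (forall M, \sum_(0 <= i < M) phi i <= z) ->
  \sum_(0 <= m < N) phi (natdist n m) <= z + z.
Proof.
move=> phi0 phiz.
apply: (@le_trans _ _ (\sum_(0 <= m < n + N) phi (natdist n m))).
  rewrite [leRHS](@big_cat_nat _ _ _ N) ?leq_addl //= lerDl.
  by apply: sumr_ge0.
rewrite (@big_cat_nat _ _ _ n) ?leq_addr //=; apply: lerD.
  rewrite big_nat_rev /=; apply: le_trans (phiz n.+1).
  rewrite [leRHS]big_nat_recl //= ler_wpDl //.
  rewrite le_eqVlt; apply/orP; left; apply/eqP.
  by apply: eq_big_nat => i iN; congr phi; rewrite /natdist; lia.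
rewrite -{1}[n]add0n big_addn addKn; apply: le_trans (phiz N).
rewrite le_eqVlt; apply/orP; left; apply/eqP.
by apply: eq_big_nat => i iN; congr phi; rewrite /natdist; lia.
Qed.

End PowerSums.

(** Common majorant of the kernels.  For m much larger than n it behaves like
(n + 1) / m^2: the regularisation, or the pairing of nu with -nu, gains one power
of m over 1 / |n - m|. *)
Definition decay {K : numFieldType} n m : K :=
  n.+1%:R / (m.+1%:R * (natdist n m).+1%:R).

Section RowSums.
Local Open Scope classical_set_scope.
Context {R : realType}.
Implicit Types (x y z r s d e : R) (n m N : nat).

(** Write x = m + 1, y = 1 + |n - m| and z = n + 1.  Since z <= x + y, a power of z
is absorbed by the larger of x and y; this leaves a product of negative powers of
x and y with exponents adding up to -1-d, at most the power -1-d of the smaller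
one. *)
Lemma powR_decay_le be d n m : 0 <= be -> 0 < d -> be + d <= 1 ->
  m.+1%:R `^ be * decay n m <=
  2 * n.+1%:R `^ (be + d) *
    (m.+1%:R `^ (- 1 - d) + (natdist n m).+1%:R `^ (- 1 - d)) :> R.
Proof.
move=> be0 d0 bed.
set z : R := n.+1%:R; set x : R := m.+1%:R; set y : R := (natdist n m).+1%:R.
have x0 : 0 < x by rewrite ltr0Sn.
have y0 : 0 < y by rewrite ltr0Sn.
have z0 : 0 < z by rewrite ltr0Sn.
have zxy : z <= x + y by rewrite -natrD ler_nat /natdist; lia.
pose s := 1 - be - d; have s0 : 0 <= s by rewrite /s; lra.
have zle w : z <= 2 * w -> 0 < w -> z `^ s <= 2 * w `^ s.
  move=> zw w0; apply: (@le_trans _ _ ((2 * w) `^ s)).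
    by rewrite ge0_ler_powR // nnegrE ?ltW // mulr_gt0.
  rewrite powRM ?(ltW w0) // ler_wpM2r ?powR_ge0 //.
  rewrite -[leRHS]powRr1 // ler_powR ?ler1n //.
  by rewrite /s; lra.
have -> : x `^ be * decay n m = z `^ (be + d) * (z `^ s * (x `^ (be - 1) * y^-1)).
  have s1 : be + d + s = 1 by rewrite /s; ring.
  rewrite /decay -/x -/y -/z mulrA -powRDr // s1 powRr1 ?ltW //.
  by rewrite powRDr // powR_inv1 ?ltW // invfM; ring.
rewrite [2 * _]mulrC -[leRHS]mulrA ler_pM2l ?powR_gt0 //.
have yE r : y `^ (r - 1) = y `^ r * y^-1 by rewrite powRDr // powR_inv1 ?ltW.
have [xy|yx] := leP x y.
  apply: (@le_trans _ _ (2 * (y `^ s * (x `^ (be - 1) * y^-1)))).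
    rewrite [leRHS]mulrA; apply: ler_wpM2r.
      by rewrite mulr_ge0 ?powR_ge0 ?invr_ge0 ?ltW.
    by apply: zle => //; lra.
  rewrite ler_pM2l // mulrCA -yE.
  apply: (@le_trans _ _ (x `^ (- 1 - d))); last by rewrite lerDl powR_ge0.
  rewrite (_ : - 1 - d = be - 1 + (s - 1)); last by rewrite /s; ring.
  rewrite [leRHS]powRDr // ler_wpM2l ?powR_ge0 // ler_powRN //.
  by rewrite /s; lra.
apply: (@le_trans _ _ (2 * (x `^ s * (x `^ (be - 1) * y^-1)))).
  rewrite [leRHS]mulrA; apply: ler_wpM2r.
    by rewrite mulr_ge0 ?powR_ge0 ?invr_ge0 ?ltW.
  by apply: zle => //; lra.
rewrite ler_pM2l // mulrA -powRDr //.
apply: (@le_trans _ _ (y `^ (- 1 - d))); last by rewrite lerDr powR_ge0.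
rewrite [- 1 - d]addrC yE ler_wpM2r ?invr_ge0 ?(ltW y0) //.
rewrite (_ : s + (be - 1) = - d); last by rewrite /s; ring.
by rewrite ler_powRN ?(ltW yx) // oppr_le0 ltW.
Qed.

Lemma sum_powR_decay_le be d n N : 0 <= be -> 0 < d -> be + d <= 1 ->
  \sum_(0 <= m < N) m.+1%:R `^ be * decay n m <=
  6 * (1 + d^-1) * n.+1%:R `^ (be + d) :> R.
Proof.
move=> be0 d0 bed.
apply: (@le_trans _ _ (\sum_(0 <= m < N) 2 * n.+1%:R `^ (be + d) *
    (m.+1%:R `^ (- 1 - d) + (natdist n m).+1%:R `^ (- 1 - d)))).
  by apply: ler_sum => m _; exact: powR_decay_le.
rewrite -mulr_sumr big_split /=.
have S1 := sum_powR_le N d0.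
have S2 := @sum_natdist_le _ (fun i => i.+1%:R `^ (- 1 - d)) _ n N
  (fun i => powR_ge0 _ _) (fun M => sum_powR_le M d0).
have z0 := powR_ge0 n.+1%:R (be + d) : 0 <= _ :> R.
rewrite [leRHS](_ : _ = 2 * n.+1%:R `^ (be + d) *
  ((1 + d^-1) + (1 + d^-1 + (1 + d^-1)))); last by ring.
by rewrite ler_wpM2l ?mulr_ge0 // lerD.
Qed.

End RowSums.

Section KernelBounds.
Context {K : numFieldType}.
Implicit Types (n m j s p : nat).

Lemma norm_natB n m : `|n%:R - m%:R| = (natdist n m)%:R :> K.
Proof.
rewrite /natdist; have [nm|mn] := leqP n m.
  by rewrite -normrN opprB -natrB // normr_nat (eqP nm).
by rewrite -natrB ?(ltnW mn) // normr_nat (eqP (ltnW mn)) addn0.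
Qed.

Lemma ler_natV u v u' v' : (0 < v)%N -> (0 < v')%N ->
  (u * v' <= u' * v)%N -> u%:R / v%:R <= u'%:R / v'%:R :> K.
Proof.
move=> v0 v'0 uv; rewrite ler_pdivrMr ?ltr0n // mulrAC.
by rewrite ler_pdivlMr ?ltr0n // -!natrM ler_nat.
Qed.

Lemma le_decay n m u v : (0 < v)%N ->
  (u * (m.+1 * (natdist n m).+1) <= 4 * n.+1 * v)%N ->
  u%:R / v%:R <= 4 * decay n m :> K.
Proof.
move=> v0 uv; rewrite /decay mulrA -natrM -natrM.
by apply: ler_natV; rewrite ?muln_gt0.
Qed.

Lemma le_decayV n m v : (0 < v)%N ->
  (m.+1 * (natdist n m).+1 <= 4 * n.+1 * v)%N ->
  v%:R^-1 <= 4 * decay n m :> K.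
Proof.
by move=> v0 uv; rewrite -[_^-1]mul1r (le_decay (u := 1%N)) // mul1n.
Qed.

Lemma decay4_ge0 n m : 0 <= 4 * decay n m :> K.
Proof. by rewrite mulr_ge0 // /decay divr_ge0 ?mulr_ge0 ?ler0n. Qed.

(** For p = 1 the regularisation is decisive: 1/(n - m) + 1/m = n / (m (n - m)). *)
Lemma norm_kerM_le p n m : (0 < p)%N -> `|kerM p n m| <= 4 * decay n m :> K.
Proof.
move=> p0; have D0 i k : 0 <= 4 * decay i k :> K by exact: decay4_ge0.
rewrite /kerM; have [->|p1] := eqVneq p 1%N; rewrite /= ?mul0r ?addr0.
  rewrite expr1 mul1r; have [->|m0] := posnP m.
    rewrite subr0 invr0 addr0 normfV normr_nat.
    have [->|n0] := posnP n; first by rewrite invr0.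
    by apply: le_decayV => //; rewrite /natdist; nia.
  have [->|nm] := eqVneq n m.
    rewrite subrr invr0 add0r normfV normr_nat.
    by apply: le_decayV => //; rewrite /natdist; nia.
  have d0 : (0 < natdist n m)%N by rewrite /natdist; lia.
  have mn0 : n%:R - m%:R != 0 :> K by rewrite subr_eq0 eqr_nat.
  have -> : (n%:R - m%:R)^-1 + m%:R^-1 = n%:R / (m%:R * (n%:R - m%:R)) :> K.
    by field; rewrite mn0 pnatr_eq0 -lt0n m0.
  rewrite normrM normfV normrM !normr_nat norm_natB -natrM.
  by apply: le_decay; [rewrite muln_gt0 m0 | nia].
rewrite normfV normrX norm_natB -natrX.
have [d0|d0] := posnP (natdist n m).
  by rewrite d0 exp0n // invr0.
apply: le_decayV; first by rewrite expn_gt0 d0.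
apply: (@leq_trans (4 * n.+1 * natdist n m ^ 2)%N).
  have : (m <= n + natdist n m)%N by rewrite /natdist; lia.
  by move: d0; rewrite expnS expn1; nia.
by rewrite leq_mul2l leq_pexp2l ?orbT //; lia.
Qed.

Lemma norm_kerMbar_le p n m : (0 < p)%N ->
  `|kerMbar p n m| <= 4 * decay n m :> K.
Proof.
move=> p0; have D0 i k : 0 <= 4 * decay i k :> K by exact: decay4_ge0.
have dnm : (natdist n m <= n + m)%N by rewrite /natdist; lia.
rewrite /kerMbar -natrD; have [->|p1] := eqVneq p 1%N; rewrite /= ?mul0r ?subr0.
  rewrite expr1 mul1r; have [->|m0] := posnP m.
    rewrite addn0 invr0 subr0 normfV normr_nat.
    have [->|n0] := posnP n; first by rewrite invr0.
    by apply: le_decayV => //; rewrite /natdist; nia.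
  have -> : (n + m)%:R^-1 - m%:R^-1 = - (n%:R / (m * (n + m))%:R) :> K.
    by rewrite natrM natrD; field; rewrite -natrD !pnatr_eq0; lia.
  rewrite normrN normrM normfV !normr_nat.
  by apply: le_decay; nia.
rewrite normfV normrX normr_nat -natrX.
have [d0|d0] := posnP (n + m)%N.
  by rewrite d0 exp0n // invr0.
apply: le_decayV; first by rewrite expn_gt0 d0.
apply: (@leq_trans (4 * n.+1 * (n + m) ^ 2)%N).
  by rewrite expnS expn1; nia.
by rewrite leq_mul2l leq_pexp2l ?orbT //; lia.
Qed.

Lemma norm_kerT_le j n m : (0 < j)%N -> `|kerT j n m| <= 12 * decay n m :> K.
Proof.
move=> j0.
have -> : 12 * decay n m = 4 * decay n m + 4 * decay n m + 4 * decay n m :> K.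
  by ring.
apply: le_trans (ler_normB _ _) _; apply: lerD.
  by apply: le_trans (ler_normD _ _) _; apply: lerD;
    rewrite ?norm_kerM_le ?norm_kerMbar_le.
have D0 i k : 0 <= 4 * decay i k :> K by exact: decay4_ge0.
case: m => [|m] /=; last by rewrite mul0r normr0.
have [n0|n0] := posnP n; first by rewrite n0 expr0n gtn_eqF // invr0 mulr0 normr0.
rewrite -natrX normrM normfV !normr_nat; apply: le_decay.
  by rewrite expn_gt0 n0.
apply: (@leq_trans (4 * n.+1)%N); first by rewrite /natdist; lia.
by rewrite leq_pmulr // expn_gt0 n0.
Qed.

Lemma natr_doubleS n : n.*2.+1%:R = 2 * n%:R + 1 :> K.
Proof. by rewrite -mul2n -addn1 natrD natrM. Qed.

Lemma half_shiftV n : (half_shift n.+1)^-1 = 2 / n.*2.+1%:R :> K.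
Proof.
by rewrite natr_doubleS half_shiftSE; field; rewrite -natrM natr1 pnatr_eq0.
Qed.

Lemma norm_weightS_le s n :
  `|(half_shift n.+1 ^+ s)^-1| <= 4 ^+ s / n.+1%:R ^+ s :> K.
Proof.
rewrite -[(half_shift _ ^+ s)^-1]exprVn half_shiftV normrX normrM normfV.
rewrite !normr_nat -expr_div_n.
by apply: lerXn2r; rewrite ?nnegrE ?divr_ge0 ?ler0n //; apply: ler_natV => //; lia.
Qed.

Lemma norm_weight_le s n :
  `|(n != 0%N)%:R / half_shift n ^+ s| <= 4 ^+ s / n.+1%:R ^+ s :> K.
Proof.
have r0 : 0 <= 4 ^+ s / n.+1%:R ^+ s :> K.
  by rewrite divr_ge0 ?exprn_ge0 ?ler0n.
case: n r0 => [|n] r0; first by rewrite mul0r normr0.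
rewrite mul1r -[(half_shift _ ^+ s)^-1]exprVn half_shiftV normrX normrM normfV.
rewrite !normr_nat -expr_div_n.
by apply: lerXn2r; rewrite ?nnegrE ?divr_ge0 ?ler0n //; apply: ler_natV => //; lia.
Qed.

Lemma le_sqrV s n : (1 < s)%N ->
  4 ^+ s / n.+1%:R ^+ s <= 4 ^+ s / n.+1%:R ^+ 2 :> K.
Proof.
move=> s1; rewrite -!natrX; apply: ler_natV; rewrite ?expn_gt0 //.
by rewrite leq_mul2l leq_pexp2l ?orbT.
Qed.

Lemma norm_kerRhat_le s n : (0 < s)%N ->
  `|kerRhat s n| <= 4 ^+ s / n.+1%:R ^+ 2 :> K.
Proof.
move=> s0; rewrite /kerRhat; have [->|s1] := eqVneq s 1%N; rewrite /= ?mul0r ?subr0.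
  rewrite mul1r !expr1 half_shiftV -natrX; have [->|n0] := posnP n.
    by rewrite invr0 subr0 normrM normfV !normr_nat; apply: ler_natV.
  have -> : 2 / n.*2.+1%:R - n%:R^-1 = - (1 / (n.*2.+1 * n)%:R) :> K.
    rewrite natrM natr_doubleS; field.
    by rewrite -natrM natr1 !pnatr_eq0; lia.
  rewrite normrN normrM normfV normr1 normr_nat.
  by apply: (@ler_natV 1 _ 4); rewrite ?expn_gt0 ?muln_gt0 ?n0 //; nia.
by apply: le_trans (norm_weightS_le s n) _; apply: le_sqrV; lia.
Qed.

Lemma norm_kerR_le s n : (0 < s)%N ->
  `|kerR s n| <= 4 ^+ s / n.+1%:R ^+ 2 :> K.
Proof.
move=> s0; rewrite /kerR; have [->|s1] := eqVneq s 1%N; last first.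
  rewrite mul0r subr0.
  by apply: le_trans (norm_weight_le s n) _; apply: le_sqrV; lia.
case: n => [|n]; first by rewrite mul0r invr0 mulr0 subr0 normr0 divr_ge0 ?exprn_ge0.
rewrite /= !mul1r !expr1 half_shiftV -natrX.
have -> : 2 / n.*2.+1%:R - n.+1%:R^-1 = 1 / (n.*2.+1 * n.+1)%:R :> K.
  rewrite natrM natr_doubleS -natr1; field.
  by rewrite -natrM nat1r natr1 !pnatr_eq0; lia.
rewrite normrM normfV normr1 normr_nat.
by apply: (@ler_natV 1 _ 4); rewrite ?expn_gt0 ?muln_gt0 //; nia.
Qed.

End KernelBounds.

(** * The parametric sums as kernel sums *)

Section ParametricSumsAsSeries.
Local Open Scope classical_set_scope.
Context {K : numFieldType}.
Implicit Types (a b : int -> K) (n m j s p N : nat).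

(** Shifting the summation index in F(1) moves the truncation point of the
regularising sum by n; the discrepancy is such a window. *)
Lemma cvg_window0 (v : nat -> K) n : v @ \oo --> 0 ->
  (fun N => \sum_(N <= m < N + n) v m) @ \oo --> 0.
Proof.
move=> v0.
have := @cvg_finite_sum _ 0 n (fun N i => v (N + i)%N) (fun=> 0).
rewrite [X in _ --> X]big1 // => lim0; apply: cvgn_ext (lim0 _) => [N|i _].
  rewrite [RHS](_ : _ = \sum_(0 + N <= m < N + n) v m) // big_addn addKn.
  by apply: eq_bigr => i _; rewrite addnC.
by rewrite cvg_shiftn.
Qed.

Lemma cvgn_lim (u : nat -> K) l : u @ \oo --> l -> limn u = l.
Proof. exact: cvg_lim. Qed.

Lemma sFE a n j : sF a n j =
  sum1 (fun k => (a (k%:Z + n%:Z) - (j == 1%N)%:R * a k%:Z) / k%:R ^+ j).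
Proof.
rewrite /sF; case: eqP => [->|_]; congr sum1; apply/funext => k.
  by rewrite mul1r expr1.
by rewrite mul0r subr0.
Qed.

Lemma sFbarE a n j : sFbar a n j =
  sum1 (fun k => (a (k%:Z - n%:Z) - (j == 1%N)%:R * a k%:Z) / k%:R ^+ j).
Proof.
rewrite /sFbar; case: eqP => [->|_]; congr sum1; apply/funext => k.
  by rewrite mul1r expr1.
by rewrite mul0r subr0.
Qed.

Lemma sum_div0 b N :
  \sum_(0 <= m < N.+1) b m%:Z / m%:R = \sum_(0 <= k < N) b k.+1%:Z / k.+1%:R.
Proof. by rewrite big_nat_recl //= invr0 mulr0 add0r. Qed.

Lemma pole1E (z w : K) p : (p == 1%N)%:R * z / w ^+ p = (p == 1%N)%:R * (z / w).
Proof. by case: eqVneq => [->|_]; rewrite ?mul1r ?expr1 // !mul0r. Qed.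

(** The indices m < n give E, those beyond n give F after the shift m = n + k, and
m = n contributes 0. *)
Lemma series_kerME b n p N : (0 < p)%N ->
  series (fun m => b m%:Z * kerM p n m) (N + n.+1)%N =
    sE b n p
    + (-1) ^+ p * series1 (fun k => (b (k%:Z + n%:Z) - (p == 1%N)%:R * b k%:Z)
                                      / k%:R ^+ p) N
    + (p == 1%N)%:R * \sum_(N.+1 <= m < N.+1 + n) b m%:Z / m%:R.
Proof.
move=> p0; rewrite /series1 /series /=.
have -> : \sum_(0 <= m < N + n.+1) b m%:Z * kerM p n m =
    \sum_(0 <= m < N + n.+1) b m%:Z / (n%:R - m%:R) ^+ p
    + (p == 1%N)%:R * \sum_(0 <= m < N + n.+1) b m%:Z / m%:R.
  by rewrite mulr_sumr -big_split; apply: eq_bigr => m _; rewrite /kerM /=; ring.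
have -> : \sum_(0 <= m < N + n.+1) b m%:Z / m%:R =
    \sum_(0 <= k < N) b k.+1%:Z / k.+1%:R
    + \sum_(N.+1 <= m < N.+1 + n) b m%:Z / m%:R.
  by rewrite addnS -addSn (@big_cat_nat _ _ _ N.+1) ?leq_addr //= sum_div0.
have -> : \sum_(0 <= m < N + n.+1) b m%:Z / (n%:R - m%:R) ^+ p =
    sE b n p + (-1) ^+ p * \sum_(0 <= k < N) b (k.+1%:Z + n%:Z) / k.+1%:R ^+ p.
  rewrite (@big_cat_nat _ _ _ n) ?leqW ?leq_addl //=; last by lia.
  congr (_ + _).
    rewrite /sE big_add1 big_nat_rev /=; apply: eq_big_nat => k kn.
    have kn' : (k < n)%N by lia.
    rewrite add0n subzn // natrB //; congr (_ / _ ^+ _); ring.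
  rewrite big_ltn; last by lia.
  rewrite subrr expr0n gtn_eqF // invr0 mulr0 add0r -[in LHS](add0n n.+1).
  rewrite big_addn addnK mulr_sumr; apply: eq_bigr => k _.
  have -> : (k + n.+1)%N%:Z = k.+1%:Z + n%:Z :> int by lia.
  have -> : n%:R - (k + n.+1)%:R = - 1 * k.+1%:R :> K by rewrite addnS -addSn natrD; ring.
  by rewrite exprMn invfM invr_sign; ring.
rewrite -!addrA; congr (_ + _).
under [X in _ = _ * X + _]eq_bigr do rewrite mulrBl pole1E.
rewrite sumrB -mulr_sumr mulrBr mulrDr.
by case: eqVneq => [->|_]; rewrite ?mul0r ?mulr0 ?expr1; ring.
Qed.

Lemma sM_cvg b n p : (0 < p)%N -> (fun k => b k%:Z / k%:R) @ \oo --> 0 ->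
  cvgn (series (fun m => b m%:Z * kerM p n m)) ->
  series (fun m => b m%:Z * kerM p n m) @ \oo --> sM b n p.
Proof.
move=> p0 b0 /cvg_ex[/= l sl].
suff -> : sM b n p = l by [].
rewrite /sM sFE.
have -> : sum1 (fun k => (b (k%:Z + n%:Z) - (p == 1%N)%:R * b k%:Z) / k%:R ^+ p)
    = (-1) ^+ p * (l - sE b n p - (p == 1%N)%:R * 0).
  apply: cvgn_lim; apply: (@cvgn_ext _ (fun N => (-1) ^+ p *
    (series (fun m => b m%:Z * kerM p n m) (N + n.+1)%N - sE b n p
      - (p == 1%N)%:R * \sum_(N.+1 <= m < N.+1 + n) b m%:Z / m%:R))) => [N|].
    have cancel (x y z : K) : x + y + z - x - z = y by ring.
    by rewrite series_kerME // cancel mulrA -expr2 sqrr_sign mul1r.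
  apply: cvgMl_tmp; apply: cvgB; first apply: cvgB.
  - by rewrite cvg_shiftn.
  - exact: cvg_cst.
  - apply: cvgMl_tmp.
    have := @cvg_window0 _ n b0.
    by rewrite -(cvg_shiftS (fun N => \sum_(N <= m < N + n) b m%:Z / m%:R)).
by rewrite mulr0 subr0 mulrA -expr2 sqrr_sign mul1r addrC subrK.
Qed.

(** The first n - 1 terms of the truncated mirror image of F are those of Ebar and
involve b at negative indices; the others are b_m / (n + m)^p for m >= 0. *)
Lemma series_kerMbarE b n p N : (0 < p)%N ->
  series1 (fun k => (b (k%:Z - n%:Z) - (p == 1%N)%:R * b k%:Z) / k%:R ^+ p)
      (N + n)%N - sEbar b n.-1 p =
    series (fun m => b m%:Z * kerMbar p n m) (N + 1)%N
    - (p == 1%N)%:R * \sum_(N.+1 <= m < N.+1 + n) b m%:Z / m%:R.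
Proof.
move=> p0; rewrite /series1 /series /= addn1.
have -> : \sum_(0 <= m < N.+1) b m%:Z * kerMbar p n m =
    \sum_(0 <= m < N.+1) b m%:Z / (n%:R + m%:R) ^+ p
    - (p == 1%N)%:R * \sum_(0 <= k < N) b k.+1%:Z / k.+1%:R.
  rewrite -sum_div0 mulr_sumr -sumrB; apply: eq_bigr => m _.
  by rewrite /kerMbar /=; ring.
under eq_bigr do rewrite mulrBl pole1E.
rewrite sumrB -mulr_sumr.
have -> : \sum_(0 <= k < N + n) b k.+1%:Z / k.+1%:R =
   \sum_(0 <= k < N) b k.+1%:Z / k.+1%:R
   + \sum_(N.+1 <= m < N.+1 + n) b m%:Z / m%:R.
  rewrite (@big_cat_nat _ _ _ N) ?leq_addr //=; congr (_ + _).
  by rewrite big_add1.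
suff -> : \sum_(0 <= k < N + n) b (k.+1%:Z - n%:Z) / k.+1%:R ^+ p =
    sEbar b n.-1 p + \sum_(0 <= m < N.+1) b m%:Z / (n%:R + m%:R) ^+ p by ring.
case: n => [|n].
  rewrite /sEbar [\sum_(1 <= k < 1) _]big_geq // add0r addn0 big_nat_recl //=.
  rewrite addr0 expr0n gtn_eqF // invr0 mulr0 add0r; apply: eq_bigr => k _.
  by rewrite subr0 add0r.
rewrite (@big_cat_nat _ _ _ n) //=; last by lia.
congr (_ + _).
  rewrite /sEbar big_add1 /=; apply: eq_bigr => k _.
  by congr (b _ / _); lia.
rewrite -{1}[n]add0n big_addn.
have -> : (N + n.+1 - n = N.+1)%N by lia.
apply: eq_bigr => m _; congr (b _ / _ ^+ _); first by lia.
by rewrite -natrD; congr _%:R; lia.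
Qed.

Lemma sMbar_cvg b n p : (0 < p)%N -> (fun k => b k%:Z / k%:R) @ \oo --> 0 ->
  cvgn (series (fun m => b m%:Z * kerMbar p n m)) ->
  series (fun m => b m%:Z * kerMbar p n m) @ \oo --> sMbar b n p.
Proof.
move=> p0 b0 /cvg_ex[/= l sl].
suff -> : sMbar b n p = l by [].
rewrite /sMbar sFbarE.
set f := fun k : nat => _ / _.
suff : series1 f @ \oo --> l - (p == 1%N)%:R * 0 + sEbar b n.-1 p.
  by move/cvgn_lim; rewrite /sum1 => ->; rewrite mulr0 subr0 addrK.
rewrite -(cvg_shiftn n).
apply: (@cvgn_ext _ (fun N => series (fun m => b m%:Z * kerMbar p n m) (N + 1)%N
    - (p == 1%N)%:R * \sum_(N.+1 <= m < N.+1 + n) b m%:Z / m%:R + sEbar b n.-1 p)).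
  by move=> N; rewrite -series_kerMbarE // subrK.
apply: cvgD; last exact: cvg_cst.
apply: cvgB; first by rewrite (cvg_shiftn 1).
apply: cvgMl_tmp; have := @cvg_window0 _ n b0.
by rewrite -(cvg_shiftS (fun N => \sum_(N <= m < N + n) b m%:Z / m%:R)).
Qed.

(** In G and L together the values of a at negative indices cancel, as they do in
Mbar.  The index nu = 0 is counted once by M and once by Mbar. *)
Lemma sTE a n j : (0 < j)%N ->
  sT a n j = sM a n j + sMbar a n j - a 0 / n%:R ^+ j.
Proof.
move=> j0; rewrite /sT /sG /sL /sM /sMbar.
have sgn z : (-1) ^+ j * ((-1) ^+ j * z) = z :> K.
  by rewrite mulrA -expr2 sqrr_sign mul1r.
case: n => [|n] /=; rewrite mulrDr sgn; last by ring.
by rewrite /sE /sEbar !big_geq // expr0n gtn_eqF // invr0 mulr0; ring.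
Qed.

Lemma sT_cvg a n j : (0 < j)%N -> (fun k => a k%:Z / k%:R) @ \oo --> 0 ->
  cvgn (series (fun m => a m%:Z * kerM j n m)) ->
  cvgn (series (fun m => a m%:Z * kerMbar j n m)) ->
  series (fun m => a m%:Z * kerT j n m) @ \oo --> sT a n j.
Proof.
move=> j0 a0 /(sM_cvg j0 a0) cM /(sMbar_cvg j0 a0) cMb; rewrite sTE //.
rewrite -cvg_shiftS -[0 : int]/(0%N%:Z); apply: (@cvgn_ext _ (fun N =>
  series (fun m => a m%:Z * kerM j n m) N.+1
  + series (fun m => a m%:Z * kerMbar j n m) N.+1 - a 0%N%:Z / n%:R ^+ j)) => [N|].
  rewrite /series /= -big_split /= [in LHS]big_nat_recl // [in RHS]big_nat_recl //=.
  rewrite [LHS]addrAC; congr (_ + _); first by rewrite /kerT /=; ring.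
  by apply: eq_bigr => m _; rewrite /kerT /= mul0r; ring.
apply: cvgB; last exact: cvg_cst.
by apply: cvgD; rewrite cvg_shiftS.
Qed.

Lemma sRhat_cvg a s : (0 < s)%N -> (fun k => a k%:Z / k%:R) @ \oo --> 0 ->
  cvgn (series (fun n => a n%:Z * kerRhat s n)) ->
  series (fun n => a n%:Z * kerRhat s n) @ \oo --> sRhat a s.
Proof.
move=> s0 a0 /cvg_ex[/= l sl]; suff -> : sRhat a s = l by [].
have -> : sRhat a s = sum1 (fun k => a (k%:Z - 1) / half_shift k ^+ s
                                     - (s == 1%N)%:R * (a k%:Z / k%:R)).
  rewrite /sRhat; case: eqP => [->|_]; congr sum1; apply/funext => k.
    by rewrite mul1r expr1.
  by rewrite mul0r subr0.
apply: cvgn_lim; rewrite -[l]subr0 -[X in _ - X](mulr0 (s == 1%N)%:R).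
apply: (@cvgn_ext _ (fun N => series (fun n => a n%:Z * kerRhat s n) N
   - (s == 1%N)%:R * (a N%:Z / N%:R))) => [N|]; last first.
  by apply: cvgB => //; apply: cvgMl_tmp.
rewrite /series1 /series /=; elim: N => [|N IHN].
  by rewrite !big_geq // invr0 !mulr0 subr0.
rewrite [RHS]big_nat_recr // -IHN [in LHS]big_nat_recr //= /kerRhat.
have -> : N.+1%:Z - 1 = N%:Z :> int by lia.
by ring.
Qed.

Lemma sR_cvg a s : cvgn (series (fun n => a n%:Z * kerR s n)) ->
  series (fun n => a n%:Z * kerR s n) @ \oo --> sR a s.
Proof.
move=> /cvg_ex[/= l sl]; suff -> : sR a s = l by [].
have -> : sR a s = sum1 (fun k => a k%:Z / half_shift k ^+ s
                                     - (s == 1%N)%:R * (a k%:Z / k%:R)).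
  rewrite /sR; case: eqP => [->|_]; congr sum1; apply/funext => k.
    by rewrite mul1r expr1.
  by rewrite mul0r subr0.
apply: cvgn_lim; move: sl; rewrite -cvg_shiftS; apply: cvgn_ext => N.
rewrite /series1 /series /= big_nat_recl //= /kerR /= mul0r invr0 mulr0 subr0.
by rewrite mulr0 add0r; apply: eq_bigr => k _; rewrite mul1r; ring.
Qed.

End ParametricSumsAsSeries.

(** * Passage to the limit *)

Section PassageToTheLimit.
Local Open Scope classical_set_scope.
Context {K : numFieldType}.
Implicit Types (a b : int -> K) (n m j s p q N : nat).

Lemma square_summable_rows (x : nat -> K) (f : nat -> nat -> K)
    (L : nat -> K) :
    square_summable (fun n m => x n * f n m) ->
    (forall n, series (f n) @ \oo --> L n) ->
  cvgn (series (fun n => x n * L n)) /\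
  (fun N => \sum_(0 <= n < N) \sum_(0 <= m < N) x n * f n m) @ \oo -->
    limn (series (fun n => x n * L n)).
Proof.
move=> [_ cf sf] fL.
have E : (fun n => limn (series (fun m => x n * f n m))) = (fun n => x n * L n).
  apply/funext => n; apply: cvgn_lim.
  apply: (@cvgn_ext _ (fun N => x n * series (f n) N)) => [N|].
    by rewrite /series /= mulr_sumr.
  exact: cvgMl_tmp.
by rewrite -E.
Qed.

Lemma sum1_shift (f : nat -> K) (g : nat -> K) :
    cvgn (series f) -> (forall n, g n.+1 = f n) ->
  cvg_sum1 g /\ sum1 g = limn (series f).
Proof.
move=> cf gf; rewrite /cvg_sum1 /sum1.
by have -> : series1 g = series f by congr series; apply/funext => n; rewrite gf.
Qed.

(** The weight of the terms at -n is set to 0 at n = 0, so that their series,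
which starts at n = 1, can be truncated on the same square as the others. *)
Lemma sum1_series0 (f : nat -> K) : cvgn (series f) -> f 0%N = 0 ->
  cvg_sum1 f /\ sum1 f = limn (series f).
Proof.
move=> cf f0.
suff cf1 : series1 f @ \oo --> limn (series f).
  by split; [apply/cvg_ex; exists (limn (series f)) | exact: cvgn_lim].
have := cf; rewrite /series1 -[X in X -> _]cvg_shiftS; apply: cvgn_ext => N.
by rewrite /series /= big_nat_recl // f0 add0r.
Qed.

(** All analytic input sits in the hypotheses; the conclusion then follows by
letting N tend to infinity in truncated_identity and by uniqueness of limits. *)
Lemma identity_of_square_summability a b p q : (0 < p)%N -> (1 < q)%N ->
    (fun k => a k%:Z / k%:R) @ \oo --> 0 ->
    (fun k => b k%:Z / k%:R) @ \oo --> 0 ->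
    (forall n, cvgn (series (fun m => b m%:Z * kerM p n m))) ->
    (forall n, cvgn (series (fun m => b m%:Z * kerMbar p n m))) ->
    (forall j n, (0 < j)%N -> cvgn (series (fun m => a m%:Z * kerM j n m))) ->
    (forall j n, (0 < j)%N -> cvgn (series (fun m => a m%:Z * kerMbar j n m))) ->
    (forall s, (0 < s)%N -> cvgn (series (fun n => a n%:Z * kerR s n))) ->
    (forall s, (0 < s)%N -> cvgn (series (fun n => a n%:Z * kerRhat s n))) ->
    (forall s, (0 < s)%N -> cvgn (series (fun n => b n%:Z * kerRhat s n))) ->
    cvgn (series (fun n => a n%:Z * b n%:Z / half_shift n.+1 ^+ (p + q))) ->
    square_summable (fun n m =>
      a n%:Z * ((n != 0%N)%:R / half_shift n ^+ q) * (b m%:Z * kerMbar p n m)) ->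
    square_summable (fun n m =>
      a n%:Z * (half_shift n.+1 ^+ q)^-1 * (b m%:Z * kerM p n m)) ->
    (forall j, (1 <= j <= p)%N -> square_summable (fun m n =>
      b m%:Z * (half_shift m.+1 ^+ (p + q - j))^-1 * (a n%:Z * kerT j m n))) ->
  [/\ cvg_sum1 (fun n => sMbar b n p / half_shift n ^+ q * a n%:Z),
      cvg_sum1 (fun n => sM b n.-1 p / half_shift n ^+ q * a (n%:Z - 1)),
      (forall j : nat, (1 <= j <= p)%N ->
        cvg_sum1 (fun n =>
          sT a n.-1 j / half_shift n ^+ (p + q - j) * b (n%:Z - 1))) &
      (-1) ^+ (p + q) *
          sum1 (fun n => sMbar b n p / half_shift n ^+ q * a n%:Z)
        + sum1 (fun n => sM b n.-1 p / half_shift n ^+ q * a (n%:Z - 1))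
      = (-1) ^+ p *
          (\sum_(1 <= j < p.+1) 'C(p + q - j - 1, q - 1)%:R *
             sum1 (fun n =>
               sT a n.-1 j / half_shift n ^+ (p + q - j) * b (n%:Z - 1)))
        - (-1) ^+ p *
          (\sum_(0 <= k < q) 'C(p + q - k - 2, p - 1)%:R *
             ((-1) ^+ k * sR a k.+1 - sRhat a k.+1) *
             sRhat b (p + q - k - 1))
        - (-1) ^+ p * 'C(p + q - 1, p)%:R * sRhat2 a b (p + q)].
Proof.
move=> p0 q1 a0 b0 bM bMb aM aMb aR aRh bRh ab sqMb sqM sqT.
have predZ n : n.+1%:Z - 1 = n%:Z :> int by lia.
have [c1 l1] := square_summable_rows sqMb (fun n => sMbar_cvg p0 b0 (bMb n)).
have [c2 l2] := square_summable_rows sqM (fun n => sM_cvg p0 b0 (bM n)).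
have gt0 j : (1 <= j <= p)%N -> (0 < j)%N by case/andP.
have T j (jp : (1 <= j <= p)%N) := square_summable_rows (sqT j jp) (fun n =>
  sT_cvg (gt0 j jp) a0 (aM j n (gt0 j jp)) (aMb j n (gt0 j jp))).
have [|s1 e1] := sum1_series0 c1; first by rewrite /= mul0r mulr0 mul0r.
have E1 : series1 (fun n => sMbar b n p / half_shift n ^+ q * a n%:Z) =
  series1 (fun n => a n%:Z * ((n != 0%N)%:R / half_shift n ^+ q) * sMbar b n p).
  by congr series; apply/funext => n /=; ring.
have [|s2 e2] := sum1_shift (g := fun n =>
  sM b n.-1 p / half_shift n ^+ q * a (n%:Z - 1)) c2.
  by move=> n; rewrite /= predZ; ring.
have s3 j : (1 <= j <= p)%N -> let f n :=
    sT a n.-1 j / half_shift n ^+ (p + q - j) * b (n%:Z - 1) in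
    cvg_sum1 f /\ sum1 f = limn (series (fun m =>
      b m%:Z * (half_shift m.+1 ^+ (p + q - j))^-1 * sT a m j)).
  move=> jp f; apply: sum1_shift (T j jp).1 _ => n.
  by rewrite /f /= predZ; ring.
have [|_ e4] := sum1_shift (g := fun n =>
  a (n%:Z - 1) * b (n%:Z - 1) / half_shift n ^+ (p + q)) ab.
  by move=> n; rewrite /= predZ.
have E1' : sum1 (fun n => sMbar b n p / half_shift n ^+ q * a n%:Z) =
    limn (series (fun n => a n%:Z * ((n != 0%N)%:R / half_shift n ^+ q) * sMbar b n p)).
  by rewrite /sum1 E1.
split; [by rewrite /cvg_sum1 E1 | exact: s2 | by move=> j /s3[] |].
rewrite E1' e2 /sRhat2 e4.
rewrite (eq_big_nat _ _ (F2 := fun j => 'C(p + q - j - 1, q - 1)%:R *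
  limn (series (fun m => b m%:Z * (half_shift m.+1 ^+ (p + q - j))^-1
                           * sT a m j)))); last first.
  by move=> j jp; rewrite (s3 j _).2 //; lia.
rewrite -(cvgn_lim (cvgD (cvgMl_tmp (a := (-1) ^+ (p + q)) l1) l2)); apply: cvgn_lim.
have sq N := @truncated_identity K (fun n => a n%:Z) (fun n => b n%:Z) N p q p0 q1.
apply: (cvgn_ext (fun N => esym (sq N))).
apply: cvgB; first apply: cvgB.
- apply: cvgMl_tmp; apply: cvg_finite_sum => j jp; apply: cvgMl_tmp.
  by apply: (T j _).2; lia.
- apply: cvgMl_tmp; apply: cvg_finite_sum => k kq; apply: cvgM.
    apply: cvgMl_tmp; apply: cvgB; first by apply: cvgMl_tmp; apply: sR_cvg; exact: aR.
    by apply: sRhat_cvg => //; exact: aRh.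
  by apply: sRhat_cvg => //; [lia | apply: bRh; lia].
by apply: cvgMl_tmp; exact: ab.
Qed.

End PassageToTheLimit.

(** * Growth conditions over the complex numbers *)

Section Growth.
Local Open Scope classical_set_scope.
Context {R : realType}.
Local Notation C := (Num.NumField.sort (R[i] : numFieldType)).
Implicit Types (x y : nat -> C) (z : C) (A B al be ga d : R) (n m s N : nat).

Definition pow_bounded x A al : Prop :=
  forall n, `|x n| <= (A * n.+1%:R `^ al)%:C.

Lemma decayC n m : (decay n m : R)%:C = decay n m :> R[i].
Proof. by rewrite /decay fmorph_div rmorphM !rmorph_nat. Qed.

Lemma natr_powR_ge1 r : 0 <= r -> forall n, 1 <= n.+1%:R `^ r :> R.
Proof. by move=> r0 n; rewrite -[leLHS](powRr0 n.+1%:R) ler_powR ?ler1n. Qed.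

Lemma powR_natXN n s : n.+1%:R `^ (- s%:R) = (n.+1%:R ^+ s)^-1 :> R.
Proof. by rewrite powRN powR_mulrn. Qed.

Lemma pow_boundedM x (w : nat -> C) A al c s : pow_bounded x A al -> 0 <= A ->
    (forall n, `|w n| <= c%:R / n.+1%:R ^+ s) ->
  pow_bounded (fun n => x n * w n) (A * c%:R) (al - s%:R).
Proof.
move=> xA A0 wc n; rewrite normrM.
have -> : A * c%:R * n.+1%:R `^ (al - s%:R)
    = A * n.+1%:R `^ al * (c%:R / n.+1%:R ^+ s).
  by rewrite powRDr // powR_natXN; ring.
rewrite rmorphM; apply: ler_pM => //.
by rewrite fmorph_div rmorphXn /= !rmorph_nat.
Qed.

Lemma pow_bounded_series x A ga d : 0 < d -> ga <= - 1 - d ->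
  pow_bounded x A ga -> 0 <= A -> cvgn (series x).
Proof.
move=> d0 gad xA A0; apply: (@cvg_series_norm_le _ _
  (fun n => A * n.+1%:R `^ (- 1 - d))) => [n|].
  apply: le_trans (xA n) _; rewrite lecR ler_wpM2l // ler_powR ?ler1n //.
exact: is_cvg_seriesZ (cvg_series_powR d0).
Qed.

Lemma sum_decay_le (be d B c : R) n N :
    0 <= be -> 0 < d -> be + d <= 1 -> 0 <= B -> 0 <= c ->
  \sum_(0 <= m < N) (B * m.+1%:R `^ be) * (c * decay n m) <=
  B * c * (6 * (1 + d^-1)) * n.+1%:R `^ (be + d).
Proof.
move=> be0 d0 bed B0 c0.
have -> : \sum_(0 <= m < N) (B * m.+1%:R `^ be) * (c * decay n m) =
    B * c * \sum_(0 <= m < N) m.+1%:R `^ be * decay n m.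
  by rewrite mulr_sumr; apply: eq_bigr => m _; ring.
by rewrite -[leRHS]mulrA ler_wpM2l ?mulr_ge0 // sum_powR_decay_le.
Qed.

Lemma norm_kernel_term y (ka : nat -> nat -> C) B be c n m :
    pow_bounded y B be -> (forall n m, `|ka n m| <= c%:R * decay n m) ->
  `|y m * ka n m| <= (B * m.+1%:R `^ be * (c%:R * decay n m))%:C.
Proof.
move=> yB kac; rewrite normrM rmorphM; apply: ler_pM => //.
by rewrite rmorphM rmorph_nat /= decayC.
Qed.

Lemma kernel_row_cvg y (ka : nat -> nat -> C) B be d c n :
    0 <= be -> 0 < d -> be + d <= 1 -> 0 <= B -> pow_bounded y B be ->
    (forall n m, `|ka n m| <= c%:R * decay n m) ->
  cvgn (series (fun m => y m * ka n m)).
Proof.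
move=> be0 d0 bed B0 yB kac.
have yk m := norm_kernel_term n m yB kac.
apply: (cvg_series_norm_le yk); apply: nondecreasing_is_cvgn.
  by apply/nondecreasing_series => m _ _; exact: norm_leC_ge0 (yk m).
exists (B * c%:R * (6 * (1 + d^-1)) * n.+1%:R `^ (be + d)) => _ [N _ <-].
by apply: sum_decay_le.
Qed.

(** The row sums cost a factor (n + 1)^(be + d), so the outer series is comparable
with the one of (n + 1)^(ga + be + d). *)
Lemma kernel_square_summable x y (ka : nat -> nat -> C) A ga B be d c :
    0 <= be -> 0 < d -> be + d <= 1 -> ga + be + d <= - 1 - d ->
    0 <= A -> 0 <= B -> pow_bounded x A ga -> pow_bounded y B be ->
    (forall n m, `|ka n m| <= c%:R * decay n m) ->
  square_summable (fun n m => x n * (y m * ka n m)).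
Proof.
move=> be0 d0 bed gbd A0 B0 xA yB kac.
pose G n m := A * n.+1%:R `^ ga * (B * m.+1%:R `^ be * (c%:R * decay n m)).
pose D := A * (B * c%:R * (6 * (1 + d^-1))).
apply: (@square_sum_cvg _ _ G (fun n => D * n.+1%:R `^ (- 1 - d))) => [n m|n N|].
- rewrite normrM rmorphM; apply: ler_pM => //; first exact: xA.
  exact: norm_kernel_term.
- rewrite /G -mulr_sumr.
  apply: (@le_trans _ _ (A * n.+1%:R `^ ga *
      (B * c%:R * (6 * (1 + d^-1)) * n.+1%:R `^ (be + d)))).
    by rewrite ler_wpM2l ?mulr_ge0 ?powR_ge0 // sum_decay_le.
  rewrite [leLHS](_ : _ = D * n.+1%:R `^ (ga + be + d)); last first.
    by rewrite -[ga + be + d]addrA (powRDr ga) // /D; ring.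
  rewrite ler_wpM2l ?ler_powR ?ler1n // /D.
  by rewrite !mulr_ge0 // addr_ge0 // invr_ge0 ltW.
exact: is_cvg_seriesZ (cvg_series_powR d0).
Qed.

Lemma natr_powRN_cvg0 r : 0 < r -> (fun n => n.+1%:R `^ (- r) : R) @ \oo --> 0.
Proof.
move=> r0; apply/cvgrPdist_le => e e0; near=> n.
rewrite sub0r normrN ger0_norm ?powR_ge0 // powRN.
rewrite -[e]invrK lef_pV2 ?posrE ?powR_gt0 ?invr_gt0 //.
have -> : e^-1 = (e^-1 `^ r^-1) `^ r.
  by rewrite -powRrM mulVf ?gt_eqF // powRr1 // invr_ge0 ltW.
rewrite ge0_ler_powR ?(ltW r0) ?nnegrE ?powR_ge0 //.
apply: (@le_trans _ _ n%:R); last by rewrite ler_nat.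
by near: n; exact: nbhs_infty_ger.
Unshelve. all: by end_near. Qed.

Lemma pow_bounded_div_cvg0 x A al : 0 <= A -> al < 1 -> pow_bounded x A al ->
  (fun n => x n / n%:R) @ \oo --> (0 : C).
Proof.
move=> A0 al1 xA.
have r0 : 0 < 1 - al by rewrite subr_gt0.
have bnd n : `|x n / n%:R| <= (2 * A * n.+1%:R `^ (- (1 - al)))%:C.
  have -> : 2 * A * n.+1%:R `^ (- (1 - al))
     = A * n.+1%:R `^ al * (2 / n.+1%:R).
    rewrite opprB (powRDr al) // powR_inv1 //; ring.
  rewrite normrM rmorphM; apply: ler_pM => //.
  rewrite normfV normr_nat fmorph_div !rmorph_nat.
  case: n => [|n]; first by rewrite invr0 divr_ge0.
  by rewrite -[X in X <= _]mul1r (@ler_natV _ 1 n.+1 2) //; lia.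
have /cvg_realC lim0 : (fun n => 2 * A * n.+1%:R `^ (- (1 - al))) @ \oo --> 2 * A * 0.
  by apply: cvgMl_tmp; exact: natr_powRN_cvg0.
apply/cvgrPdist_le => e e0.
move/cvgrPdist_le/(_ e e0) : lim0; apply: filterS => n.
rewrite mulr0 sub0r normrN => An; rewrite sub0r normrN.
apply: le_trans (bnd n) (le_trans _ An).
exact: real_ler_norm (ger0_real (le_trans (normr_ge0 _) (bnd n))).
Qed.

Lemma littleo_pow_bounded (a : int -> R[i]) (alpha al : R) :
    littleo_pow a alpha -> alpha <= al -> 0 <= al ->
  exists2 A, 0 <= A & pow_bounded (fun n => a n%:Z) A al.
Proof.
move=> [/eqoP ao _] aal al0.
have [N _ aN] := ao 1 ltr01.
pose r n : R := complex.Re `|a n%:Z|.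
have rE n : `|a n%:Z| = (r n)%:C by rewrite /r normc_def.
have r0 n : 0 <= r n by rewrite -lecR -rE; exact: normr_ge0.
exists (1 + \sum_(0 <= k < N.+1) r k); first by rewrite addr_ge0 ?sumr_ge0.
move=> n; rewrite rE lecR.
have [Nn|nN] := ltnP N n.
  apply: (@le_trans _ _ (n.+1%:R `^ al)); last first.
    by rewrite ler_peMl ?powR_ge0 // lerDl sumr_ge0.
  have := aN n (ltnW Nn); rewrite /= mul1r rE normc_real lecR.
  move/le_trans; apply; rewrite ger0_norm ?powR_ge0 //.
  apply: (@le_trans _ _ (n%:R `^ al)); first by rewrite ler_powR // ler1n; lia.
  by rewrite ge0_ler_powR ?nnegrE // ler_nat.
apply: (@le_trans _ _ (1 + \sum_(0 <= k < N.+1) r k)); last first.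
  by rewrite ler_peMr ?natr_powR_ge1 // addr_ge0 ?sumr_ge0.
rewrite ler_wpDl // (bigD1_seq n) ?mem_index_iota ?iota_uniq //=.
by rewrite lerDl sumr_ge0.
Qed.

End Growth.

(** Raising the growth exponents to nonnegative ones keeps all strict inequalities;
half of the smallest gap is then available as d.  The last inequality contains d
twice: once for the row sums, once for the convergence of the outer series. *)
Lemma growth_exponents (R : realType) (alpha beta : R) (q : nat) :
    alpha < 1 -> beta < 1 -> (1 < q)%N -> (q = 2%N -> alpha + beta < 1) ->
  exists al be d : R, [/\ [/\ alpha <= al, 0 <= al & al + d <= 1],
    [/\ beta <= be, 0 <= be & be + d <= 1], 0 < d &
    al + be + d + d + 1 <= q%:R].
Proof.
move=> a1 b1 q1 ab.
pose al := Num.max alpha 0; pose be := Num.max beta 0.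
have [aal al0 al1] : [/\ alpha <= al, 0 <= al & al < 1].
  by rewrite /al !le_max gt_max a1 ltr01 !lexx orbT.
have [bbe be0 be1] : [/\ beta <= be, 0 <= be & be < 1].
  by rewrite /be !le_max gt_max b1 ltr01 !lexx orbT.
have qab : al + be + 1 < q%:R.
  have [q2|q2] := eqVneq q 2%N.
    rewrite q2; have := ab q2; rewrite /al /be.
    by rewrite /Num.max /Order.max; do 2 case: ifP => ?; lra.
  have : 3 <= q%:R :> R by rewrite (ler_nat _ 3); lia.
  by lra.
pose d := Num.min (Num.min (1 - al) (1 - be)) (q%:R - 1 - al - be) / 2.
have : 0 < d by rewrite divr_gt0 // !lt_min; lra.
have : [/\ d * 2 <= 1 - al, d * 2 <= 1 - be & d * 2 <= q%:R - 1 - al - be].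
  rewrite /d divfK //; split; rewrite ?ge_min ?lexx ?orbT //.
move=> [d1 d2 d3] d0; exists al, be, d; split => //; try split => //; lra.
Qed.

Theorem theorem3p1 (R : realType) (a b : int -> R[i]) (alpha beta : R)
    (p q : nat)
    (halpha : alpha < 1) (hbeta : beta < 1)
    (ha : littleo_pow a alpha) (hb : littleo_pow b beta)
    (hp : (0 < p)%N) (hq : (1 < q)%N)
    (* only restricts q = 2, where the series below can otherwise diverge *)
    (hconv : q = 2%N -> alpha + beta < 1) :
  [/\ cvg_sum1 (fun n => sMbar b n p / half_shift n ^+ q * a n%:Z),
      cvg_sum1 (fun n => sM b n.-1 p / half_shift n ^+ q * a (n%:Z - 1)),
      (forall j : nat, (1 <= j <= p)%N ->
        cvg_sum1 (fun n =>
          sT a n.-1 j / half_shift n ^+ (p + q - j) * b (n%:Z - 1))) &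
      (-1) ^+ (p + q) *
          sum1 (fun n => sMbar b n p / half_shift n ^+ q * a n%:Z)
        + sum1 (fun n => sM b n.-1 p / half_shift n ^+ q * a (n%:Z - 1))
      = (-1) ^+ p *
          (\sum_(1 <= j < p.+1) 'C(p + q - j - 1, q - 1)%:R *
             sum1 (fun n =>
               sT a n.-1 j / half_shift n ^+ (p + q - j) * b (n%:Z - 1)))
        - (-1) ^+ p *
          (\sum_(0 <= k < q) 'C(p + q - k - 2, p - 1)%:R *
             ((-1) ^+ k * sR a k.+1 - sRhat a k.+1) *
             sRhat b (p + q - k - 1))
        - (-1) ^+ p * 'C(p + q - 1, p)%:R * sRhat2 a b (p + q)].
Proof.
have [al [be [d [[aal al0 ald] [bbe be0 bed] d0 abd]]]] :=
  growth_exponents halpha hbeta hq hconv.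
have [A A0 aA] := littleo_pow_bounded ha aal al0.
have [B B0 bB] := littleo_pow_bounded hb bbe be0.
have al1 : al < 1 by lra.
have be1 : be < 1 by lra.
have hqR s : (q <= s)%N -> (q%:R <= s%:R :> R) by rewrite ler_nat.
have ker_series (c : int -> R[i]) D ga (w : nat -> R[i]) s :
    0 <= D -> ga + d <= 1 -> pow_bounded (fun n => c n%:Z) D ga ->
    (forall n, `|w n| <= 4 ^+ s / n.+1%:R ^+ 2) ->
    cvgn (series (fun n => (c n%:Z * w n : (R[i] : numFieldType)))).
  move=> D0 gad cD wn; apply: (pow_bounded_series (d := d) d0 _
    (pow_boundedM (c := 4 ^ s) (s := 2) cD D0 _)) => //.
  - by lra.
  - by move=> n; rewrite natrX.
  - by rewrite mulr_ge0.
apply: identity_of_square_summability => //.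
- exact: pow_bounded_div_cvg0 A0 al1 aA.
- exact: pow_bounded_div_cvg0 B0 be1 bB.
- move=> n; apply: (kernel_row_cvg be0 d0 bed B0 bB (c := 4)
    (ka := kerM p)) => i m.
  exact: norm_kerM_le.
- move=> n; apply: (kernel_row_cvg be0 d0 bed B0 bB (c := 4)
    (ka := kerMbar p)) => i m.
  exact: norm_kerMbar_le.
- move=> j n j0; apply: (kernel_row_cvg al0 d0 ald A0 aA (c := 4)
    (ka := kerM j)) => i m.
  exact: norm_kerM_le.
- move=> j n j0; apply: (kernel_row_cvg al0 d0 ald A0 aA (c := 4)
    (ka := kerMbar j)) => i m.
  exact: norm_kerMbar_le.
- by move=> s s0; apply: (ker_series a A al _ s) => // n; exact: norm_kerR_le.
- by move=> s s0; apply: (ker_series a A al _ s) => // n; exact: norm_kerRhat_le.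
- by move=> s s0; apply: (ker_series b B be _ s) => // n; exact: norm_kerRhat_le.
- have abB : pow_bounded (fun n => a n%:Z * b n%:Z) (A * B) (al + be).
    move=> n; rewrite normrM.
    have -> : A * B * n.+1%:R `^ (al + be)
        = A * n.+1%:R `^ al * (B * n.+1%:R `^ be).
      by rewrite (powRDr al) //; ring.
    by rewrite rmorphM; apply: ler_pM.
  apply: (pow_bounded_series (d := d) d0 _
    (pow_boundedM (c := 4 ^ (p + q)) (s := p + q) abB _ _)) => //.
  + by have := hqR (p + q)%N (leq_addl _ _); lra.
  + by rewrite mulr_ge0.
  + by move=> n; rewrite natrX; exact: norm_weightS_le.
  + by rewrite !mulr_ge0.
- have gaM : al - q%:R + be + d <= - 1 - d by lra.
  have xM : pow_bounded (fun n => a n%:Z * ((n != 0%N)%:R / half_shift n ^+ q))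
      (A * (4 ^ q)%:R) (al - q%:R).
    apply: pow_boundedM aA A0 _ => n; rewrite natrX; exact: norm_weight_le.
  apply: (kernel_square_summable (c := 4) be0 d0 bed gaM _ B0 xM bB).
    by rewrite mulr_ge0.
  by move=> n m; exact: norm_kerMbar_le.
- have gaM : al - q%:R + be + d <= - 1 - d by lra.
  have xM : pow_bounded (fun n => a n%:Z * (half_shift n.+1 ^+ q)^-1)
      (A * (4 ^ q)%:R) (al - q%:R).
    apply: pow_boundedM aA A0 _ => n; rewrite natrX; exact: norm_weightS_le.
  apply: (kernel_square_summable (c := 4) be0 d0 bed gaM _ B0 xM bB).
    by rewrite mulr_ge0.
  by move=> n m; exact: norm_kerM_le.
move=> j /andP[j0 jp].
have gaM : be - (p + q - j)%:R + al + d <= - 1 - d.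
  have /hqR : (q <= p + q - j)%N by rewrite addnC -addnBA // leq_addr.
  by lra.
have xM : pow_bounded (fun n => b n%:Z * (half_shift n.+1 ^+ (p + q - j))^-1)
    (B * (4 ^ (p + q - j))%:R) (be - (p + q - j)%:R).
  apply: pow_boundedM bB B0 _ => n; rewrite natrX; exact: norm_weightS_le.
apply: (kernel_square_summable (c := 12) al0 d0 ald gaM _ A0 xM aA).
  by rewrite mulr_ge0.
by move=> n m; exact: norm_kerT_le.
Qed.
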